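(* Let $G$ be a finite simple graph that is $\{\text{co-claw}, \text{co-gem}\}$-free. Then $\mathrm{had}(G) \geq \chi(G)$.
   Context: Graphs are finite, loopless and without parallel edges. $\chi(G)$ denotes the chromatic number of $G$, and $A\sqcup B$ denotes the disjoint union of graphs $A$ and $B$. For a set $S$ of graphs, $G$ is $S$-free if no induced subgraph of $G$ is isomorphic to a member of $S$. The co-claw is $K_3\sqcup K_1$ (the complement of the claw $K_{1,3}$). The co-gem is $P_4\sqcup K_1$, where $P_4$ is the path on 4 vertices. A graph $H$ is a minor of $G$ if $H$ can be obtained from $G$ by deleting vertices and edges and contracting edges. The Hadwiger number $\mathrm{had}(G)$ is the maximum integer $n$ such that the complete graph $K_n$ is a minor of $G$. *)

(* Defs.v *)
From mathcomp Require Import all_boot.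
From mathcomp Require Import boolp.

Set Implicit Arguments.
Unset Strict Implicit.
Unset Printing Implicit Defensive.

Record sgraph := SGraph {
  vertex :> finType;
  adj : rel vertex;
  adj_sym : symmetric adj;
  adj_irrefl : irreflexive adj }.

Arguments adj {G} x y : rename.
Arguments adj_sym {G} x y : rename.
Arguments adj_irrefl {G} x : rename.

Definition isomorphic (G H : sgraph) : Prop :=
  exists2 f : G -> H, bijective f & {mono f : x y / adj x y}.

Section Constructions.
Variable G : sgraph.

Section Induced.
Variable S : {set G}.
Definition induced_adj : rel {x : G | x \in S} :=
  fun x y => adj (val x) (val y).
Lemma induced_sym : symmetric induced_adj.
Proof. by move=> x y; apply: adj_sym. Qed.
Lemma induced_irrefl : irreflexive induced_adj.
Proof. by move=> x; apply: adj_irrefl. Qed.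
Definition induced : sgraph := SGraph induced_sym induced_irrefl.
End Induced.

Definition del_vertex (v : G) : sgraph := induced [set~ v]%SET.

Section DelEdge.
Variables u v : G.
Definition del_edge_adj : rel G :=
  fun x y => adj x y && ([set x; y]%SET != [set u; v]%SET).
Lemma del_edge_sym : symmetric del_edge_adj.
Proof. by move=> x y; rewrite /del_edge_adj adj_sym setUC. Qed.
Lemma del_edge_irrefl : irreflexive del_edge_adj.
Proof. by move=> x; rewrite /del_edge_adj adj_irrefl. Qed.
Definition del_edge : sgraph := SGraph del_edge_sym del_edge_irrefl.
End DelEdge.

(* [contract u v] identifies [v] with [u]: the merged vertex is represented by
   [u], which becomes adjacent to all former neighbours of [u] or [v]; parallel
   edges are merged and the loop is dropped.  It is edge contraction when
   [adj u v] (see [minor]). *)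
Section Contract.
Variables u v : G.
Definition contract_adj : rel {x : G | x != v} := fun x y =>
  (x != y) && [|| adj (val x) (val y),
                  (val x == u) && adj v (val y) |
                  (val y == u) && adj v (val x)].
Lemma contract_sym : symmetric contract_adj.
Proof.
move=> x y; rewrite /contract_adj eq_sym adj_sym.
by congr (_ && (_ || _)); rewrite orbC.
Qed.
Lemma contract_irrefl : irreflexive contract_adj.
Proof. by move=> x; rewrite /contract_adj eqxx. Qed.
Definition contract : sgraph := SGraph contract_sym contract_irrefl.
End Contract.

End Constructions.

Section Complete.
Variable n : nat.
Definition complete_adj : rel 'I_n := fun x y => x != y.
Lemma complete_sym : symmetric complete_adj.
Proof. by move=> x y; rewrite /complete_adj eq_sym. Qed.
Lemma complete_irrefl : irreflexive complete_adj.
Proof. by move=> x; rewrite /complete_adj eqxx. Qed.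
Definition complete : sgraph := SGraph complete_sym complete_irrefl.
End Complete.

Section Path.
Variable n : nat.
Definition path_adj : rel 'I_n :=
  fun x y => (x.+1 == y :> nat) || (y.+1 == x :> nat).
Lemma path_sym : symmetric path_adj.
Proof. by move=> x y; rewrite /path_adj orbC. Qed.
Lemma path_irrefl : irreflexive path_adj.
Proof. by move=> x; rewrite /path_adj orbb eqn_leq ltnn. Qed.
Definition path_graph : sgraph := SGraph path_sym path_irrefl.
End Path.

Section DisjointUnion.
Variables A B : sgraph.
Definition disjoint_union_adj : rel (A + B)%type := fun x y =>
  match x, y with
  | inl a, inl a' => adj a a'
  | inr b, inr b' => adj b b'
  | _, _ => false
  end.
Lemma disjoint_union_sym : symmetric disjoint_union_adj.
Proof. by case=> x [] y //=; apply: adj_sym. Qed.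
Lemma disjoint_union_irrefl : irreflexive disjoint_union_adj.
Proof. by case=> x /=; apply: adj_irrefl. Qed.
Definition disjoint_union : sgraph :=
  SGraph disjoint_union_sym disjoint_union_irrefl.
End DisjointUnion.

Definition co_claw : sgraph := disjoint_union (complete 3) (complete 1).
Definition co_gem : sgraph := disjoint_union (path_graph 4) (complete 1).

Definition free (F : sgraph -> Prop) (G : sgraph) : Prop :=
  forall H : sgraph, F H -> ~ exists S : {set G}, isomorphic (induced S) H.

Definition colorable (G : sgraph) (k : nat) : bool :=
  [exists f : {ffun G -> 'I_k},
    [forall x, forall y, adj x y ==> (f x != f y)]].

Lemma colorable_exists (G : sgraph) : exists k, colorable G k.
Proof.
exists #|G|; apply/existsP; exists [ffun x => enum_rank x].
apply/forallP=> x; apply/forallP=> y; apply/implyP=> xy; rewrite !ffunE.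
by apply: contraTneq xy => /enum_rank_inj ->; rewrite adj_irrefl.
Qed.

Definition chromatic_number (G : sgraph) : nat := ex_minn (colorable_exists G).

(* [minor H G]: [H] is a minor of [G]. *)
Inductive minor (H : sgraph) : sgraph -> Prop :=
| MinorIso (G : sgraph) : isomorphic G H -> minor H G
| MinorDelVertex (G : sgraph) (v : G) : minor H (del_vertex v) -> minor H G
| MinorDelEdge (G : sgraph) (u v : G) : adj u v -> minor H (del_edge u v) -> minor H G
| MinorContract (G : sgraph) (u v : G) : adj u v -> minor H (contract u v) -> minor H G.

Lemma minor_card (H G : sgraph) : minor H G -> #|H| <= #|G|.
Proof.
elim=> {G} [G [f bij_f _]|G v _ IH|G u v _ _ IH|G u v _ _ IH] //.
- by rewrite (bij_eq_card bij_f).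
- by apply: leq_trans IH _; rewrite card_sig; apply: max_card.
- by apply: leq_trans IH _; rewrite card_sig; apply: max_card.
Qed.

Lemma minor_complete0 (G : sgraph) : minor (complete 0) G.
Proof.
have [n] := ubnP #|G|; elim: n G => // n IH G leGn.
case: (pickP (@predT G)) => [v _|G0].
  apply: (@MinorDelVertex _ _ v); apply: IH.
  move: leGn; rewrite ltnS; apply: leq_trans; rewrite card_sig; apply: proper_card.
  by apply/properP; split; [apply/subsetP | exists v; rewrite ?inE ?eqxx].
apply: MinorIso; have F (x : G) : False by have := G0 x.
exists (fun x : G => False_rect _ (F x)); last by move=> x; case: (F x).
by exists (fun i : 'I_0 => False_rect G (notF (ltn_ord i))) => x;
  [case: (F x) | case: x].
Qed.

Lemma complete_minor_exists (G : sgraph) :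
  exists n, `[< minor (complete n) G >].
Proof. by exists 0; apply/asboolP; apply: minor_complete0. Qed.

Lemma complete_minor_bound (G : sgraph) (n : nat) :
  `[< minor (complete n) G >] -> n <= #|G|.
Proof. by move/asboolP/minor_card; rewrite card_ord. Qed.

Definition hadwiger_number (G : sgraph) : nat :=
  ex_maxn (complete_minor_exists G) (@complete_minor_bound G).

(* Main.v *)
Require Import Defs.
From mathcomp Require Import all_boot.
From mathcomp Require Import boolp.

(** The proof is by induction on a vertex set [U]: the subgraph on [U] has, for
    some [k], both a proper colouring with [k] colours and a model of the
    complete graph with [k] branch sets, each of which is a vertex or an edge.
    With [U] the whole vertex set, this places [k] between the chromatic number
    and the Hadwiger number.

    Suppose that [U] contains an induced path p - q - r - s.  Two stable sets
    are then removed: [P4_side p q r s], which contains p and r, and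
    [P4_side s r q p], which contains q and s.  Together they contain every
    vertex that misses both p and q, and every vertex that misses both r and s;
    hence each of the edges pq and rs has a neighbour of every remaining
    vertex.  So pq and rs, which are joined by qr, can be added as two branch
    sets to any model of the remaining graph, at the cost of two colours.  That
    the two sets are stable ([P4_side_stable]) and that the edges dominate the
    rest ([P4_edge_dominates]) is where the forbidden subgraphs enter: every
    triangle, and every induced path on four vertices, meets the closed
    neighbourhood of every vertex.

    If [U] contains no such path, its clique number equals its chromatic number
    ([P4_free_clique_coloring]): a maximal stable set [I] meets a suitable
    extension of every clique outside [I], so removing [I] lowers both numbers.
    The model then consists of the vertices of a clique. *)

Set Implicit Arguments.
Unset Strict Implicit.
Unset Printing Implicit Defensive.

(** * Forbidden induced subgraphs *)

Section ForbiddenSubgraphs.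
Variable G : sgraph.

(** Turns an explicit list of vertices into the induced copy, given as a vertex
    set with an isomorphism, that [free] speaks about. *)
Lemma embedding_induced (H : sgraph) (h : H -> G) :
  injective h -> {mono h : x y / adj x y} ->
  exists S : {set G}, isomorphic (induced S) H.
Proof.
move=> h_inj h_mono; pose S := [set h x | x in [set: H]]%SET; exists S.
pose g (x : H) : induced S := Sub (h x) (imset_f h (in_setT x)).
have g_inj : injective g by move=> x y /(congr1 val) /h_inj.
have [f gK fK] : bijective g.
  by apply: inj_card_bij => //; rewrite card_sig (card_imset _ h_inj) cardsT.
exists f; first by exists g.
by move=> x y; rewrite -[in RHS](fK x) -[in RHS](fK y) -h_mono.
Qed.

(** The adjacencies make the four vertices distinct: were [d] a vertex of the
    triangle, it would be adjacent to the other two. *)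
Lemma co_claw_free (a b c d : G) :
  free (fun H => H = co_claw \/ H = co_gem) G ->
  adj a b -> adj a c -> adj b c ->
  ~~ adj d a -> ~~ adj d b -> ~~ adj d c -> False.
Proof.
move=> Gfree ab ac bc /negPf da /negPf db /negPf dc.
have [] := Gfree co_claw; first by left.
pose h (v : co_claw) : G :=
  match v with inl i => nth a [:: a; b; c] i | inr _ => d end.
have h_mono : {mono h : x y / adj x y}.
  have irr (x : G) := adj_irrefl x.
  by case=> [[[|[|[|//]]] ?]|[[|//] ?]] [[[|[|[|//]]] ?]|[[|//] ?]] /=;
     rewrite ?irr ?ab ?ac ?bc ?da ?db ?dc // adj_sym ?ab ?ac ?bc ?da ?db ?dc.
apply: (embedding_induced (h := h)) => //.
have ne (x y : G) : adj x y -> x = y -> False.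
  by move=> xy e; move: xy; rewrite e adj_irrefl.
case=> [[[|[|[|//]]] ?]|[[|//] ?]] [[[|[|[|//]]] ?]|[[|//] ?]] //= E;
  try (by congr inl; apply: val_inj); try (by congr inr; apply: val_inj);
  exfalso; first
  [ exact: ne E | exact: ne (esym E)
  | by move: da db dc; rewrite ?E ?[adj b a]adj_sym ?[adj c a]adj_sym ?ab ?ac ?bc
  | by move: da db dc; rewrite -?E ?[adj b a]adj_sym ?[adj c a]adj_sym ?ab ?ac ?bc].
Qed.

Definition induced_P4 (p q r s : G) : bool :=
  [&& adj p q, adj q r, adj r s, ~~ adj p r, ~~ adj p s & ~~ adj q s].

Lemma induced_P4_rev p q r s : induced_P4 p q r s -> induced_P4 s r q p.
Proof.
case/and5P=> pq qr rs pr /andP[ps qs]; rewrite /induced_P4.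
by rewrite adj_sym rs adj_sym qr adj_sym pq adj_sym qs adj_sym ps adj_sym pr.
Qed.

Lemma co_gem_free (p q r s t : G) :
  free (fun H => H = co_claw \/ H = co_gem) G ->
  induced_P4 p q r s ->
  ~~ adj t p -> ~~ adj t q -> ~~ adj t r -> ~~ adj t s -> False.
Proof.
move=> Gfree /and5P[pq qr rs /negPf pr /andP[/negPf ps /negPf qs]].
move=> /negPf tp /negPf tq /negPf tr /negPf ts.
have [] := Gfree co_gem; first by right.
pose h (v : co_gem) : G :=
  match v with inl i => nth p [:: p; q; r; s] i | inr _ => t end.
have irr (x : G) := adj_irrefl x.
have h_mono : {mono h : x y / adj x y}.
  by case=> [[[|[|[|[|//]]]] ?]|[[|//] ?]] [[[|[|[|[|//]]]] ?]|[[|//] ?]] /=;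
     rewrite ?irr ?pq ?qr ?rs ?pr ?ps ?qs ?tp ?tq ?tr ?ts // adj_sym
       ?pq ?qr ?rs ?pr ?ps ?qs ?tp ?tq ?tr ?ts.
apply: (embedding_induced (h := h)) => //.
have qp : adj q p by rewrite adj_sym.
have rq : adj r q by rewrite adj_sym.
have sr : adj s r by rewrite adj_sym.
(* Any two of the five vertices are told apart by a third one. *)
have sep (z x y : G) : adj x z -> adj y z = false -> x = y -> False.
  by move=> xz yz e; move: yz; rewrite -e xz.
have sq : adj s q = false by rewrite adj_sym.
have sp : adj s p = false by rewrite adj_sym.
have rp : adj r p = false by rewrite adj_sym.
case=> [[[|[|[|[|//]]]] ?]|[[|//] ?]] [[[|[|[|[|//]]]] ?]|[[|//] ?]] //= E;
  try (by congr inl; apply: val_inj); try (by congr inr; apply: val_inj);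
  exfalso; first
  [ by apply: (sep p _ _ _ _ E) | by apply: (sep q _ _ _ _ E)
  | by apply: (sep r _ _ _ _ E) | by apply: (sep s _ _ _ _ E)
  | by apply: (sep p _ _ _ _ (esym E)) | by apply: (sep q _ _ _ _ (esym E))
  | by apply: (sep r _ _ _ _ (esym E)) | by apply: (sep s _ _ _ _ (esym E))].
Qed.

End ForbiddenSubgraphs.

(** * Models and minors *)

(** A vertex with label [i < k] belongs to the branch set [i]; labels from [k] on
    mark the vertices to be deleted.  Branch sets are required to be cliques rather
    than connected sets, because contracting an edge of a clique leaves a
    clique: the hypotheses then pass unchanged to the contracted graph, and the
    induction ends when every label is used once. *)
Lemma labelling_minor (k : nat) (G : sgraph) (m : G -> nat) :
  (forall i, i < k -> exists x, m x = i) ->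
  (forall x y, m x = m y -> m x < k -> x != y -> adj x y) ->
  (forall i j, i < j -> j < k -> exists x y, [/\ m x = i, m y = j & adj x y]) ->
  minor (complete k) G.
Proof.
have [n] := ubnP #|G|; elim: n G m => // n IH G m leGn onto cl touch.
have lt_del (v : G) (P : pred G) : ~~ P v -> #|{: {x : G | P x}}| < n.
  move=> Pv; rewrite card_sig; rewrite ltnS in leGn; apply: leq_trans leGn.
  by apply: proper_card; apply/properP; split; [apply/subsetP | exists v].
have [[v mv]|used] := pselect (exists v, k <= m v).
  have keep i x : i < k -> m x = i -> x \in [set~ v]%SET.
    by rewrite !inE => ik mx; apply: contraTneq ik => xv; rewrite -mx xv -leqNgt.
  apply: (@MinorDelVertex _ _ v); apply: (IH (del_vertex v) (fun x => m (val x))).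
  - by apply: (lt_del v); rewrite !inE eqxx.
  - move=> i ik; have [x mx] := onto i ik.
    by exists (Sub x (keep _ _ ik mx)).
  - by move=> x y E xk xy; apply: cl.
  - move=> i j ij jk; have [x [y [mx my xy]]] := touch i j ij jk.
    by exists (Sub x (keep _ _ (ltn_trans ij jk) mx)), (Sub y (keep _ _ jk my)).
have {}used x : m x < k by rewrite ltnNge; apply/negP => kx; apply: used; exists x.
have [[u [v [muv uv]]]|inj] := pselect (exists u v, m u = m v /\ u != v).
  apply: (@MinorContract _ _ u v); first exact: cl.
  (* [rep] sends each vertex to its image under the contraction. *)
  pose rep x := if x == v then u else x.
  have repP x : rep x != v by rewrite /rep; case: ifP => [_|->].
  have m_rep x : m (rep x) = m x by rewrite /rep; case: eqP => // ->.
  apply: (IH (contract u v) (fun x => m (val x))).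
  - by apply: (lt_del v); rewrite eqxx.
  - by move=> i ik; have [x mx] := onto i ik; exists (Sub (rep x) (repP x)); rewrite /= m_rep.
  - by move=> x y E xk xy; rewrite /adj /= /contract_adj xy cl.
  - move=> i j ij jk; have [x [y [mx my xy]]] := touch i j ij jk.
    have mxy : m x != m y by rewrite mx my neq_ltn ij.
    exists (Sub (rep x) (repP x)), (Sub (rep y) (repP y)); rewrite /= !m_rep; split=> //.
    rewrite /adj /= /contract_adj; apply/andP; split.
      apply: contraNneq mxy => /(congr1 val) e.
      by rewrite -(m_rep x) -(m_rep y); apply/eqP; congr m; exact: e.
    move: xy mxy; rewrite /= /rep; case: (x =P v) => [->|_]; case: (y =P v) => [->|_] xy mxy.
    + by rewrite eqxx in mxy.
    + by rewrite eqxx xy orbT.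
    + by rewrite eqxx [adj v x]adj_sym xy !orbT.
    + by rewrite xy.
have m_inj : injective m.
  by move=> x y E; apply: contrapT => /eqP xy; apply: inj; exists x, y.
apply: MinorIso; pose f (x : G) : complete k := Ordinal (used x).
have f_inj : injective f by move=> x y /(congr1 val) /m_inj.
exists f.
  pose g (i : 'I_k) := sval (cid (onto i (ltn_ord i))).
  have mg (i : 'I_k) : m (g i) = i by rewrite /g; case: cid.
  by exists g => [x|i]; [apply: m_inj | apply: val_inj]; rewrite /= mg.
have adj_lt x y : m x < m y -> adj x y.
  move=> xy; have [x' [y' [/m_inj-> /m_inj->]]] := touch _ _ xy (used y).
  by [].
move=> x y; rewrite {1}/adj /= /complete_adj (inj_eq f_inj).
have [->|xy] := eqVneq x y; first by rewrite adj_irrefl.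
have: m x != m y by rewrite (inj_eq m_inj).
by rewrite neq_ltn => /orP[] /adj_lt // xy'; rewrite adj_sym.
Qed.

Section Models.
Variable G : sgraph.
Implicit Types (U A B I : {set G}) (Bs : seq {set G}).

Definition linked A B : bool :=
  [disjoint A & B] && [exists x in A, exists y in B, adj x y].

Definition clique_model U Bs : Prop :=
  {in Bs, forall B, [/\ B != set0, B \subset U
                      & {in B &, forall x y, x != y -> adj x y}]}
  /\ pairwise linked Bs.

(** The label of a vertex is the position of its block; the vertices in no block
    get the label [size Bs], which [labelling_minor] discards. *)
Lemma clique_model_minor Bs :
  clique_model [set: G] Bs -> minor (complete (size Bs)) G.
Proof.
case=> blocks /(pairwiseP set0) link.
pose m x := find (fun B : {set G} => x \in B) Bs.
have mem_m x : m x < size Bs -> x \in nth set0 Bs (m x).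
  by move=> xk; apply: (@nth_find _ set0 (fun B : {set G} => x \in B)); rewrite has_find.
have mP i x : i < size Bs -> x \in nth set0 Bs i -> m x = i.
  move=> ik xi; have : m x <= i by rewrite leqNgt; apply/negP => /(before_find set0); rewrite xi.
  rewrite leq_eqVlt => /predU1P[// | mi].
  have mk := ltn_trans mi ik.
  have /andP[/pred0P/(_ x)] := link _ _ mk ik mi.
  by rewrite /= xi mem_m.
apply: (labelling_minor (m := m)).
- move=> i ik; have [/set0Pn[x xi] _ _] := blocks _ (mem_nth set0 ik).
  by exists x; apply: mP.
- move=> x y E xk xy; have [_ _ cl] := blocks _ (mem_nth set0 xk).
  by apply: cl => //; [exact: mem_m | rewrite E mem_m // -E].
- move=> i j ij jk; have ik := ltn_trans ij jk.
  have /andP[_ /exists_inP[x xi /exists_inP[y yj xy]]] := link _ _ ik jk ij.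
  by exists x, y; split=> //; apply: mP.
Qed.

(** * Colouring and cliques without induced paths *)

(** Colours are natural numbers below a bound, not ordinals, so that adding a
    colour keeps the colours already given. *)
Definition colorable_on U k : Prop :=
  exists f : G -> nat, {in U, forall x, f x < k} /\
    {in U &, forall x y, adj x y -> f x != f y}.

Definition stable I : bool := [forall x in I, forall y in I, ~~ adj x y].

Lemma stableP I : reflect {in I &, forall x y, ~~ adj x y} (stable I).
Proof.
apply: (iffP forall_inP) => [h x y xI yI | h x xI].
  by have /forall_inP := h x xI; apply.
by apply/forall_inP => y yI; apply: h.
Qed.

Lemma colorable_on_stable U I k :
  stable I -> colorable_on (U :\: I) k -> colorable_on U k.+1.
Proof.
move=> /stableP stI [f [fk fP]]; exists (fun x => if x \in I then k else f x).
have fk' x : x \in U -> x \notin I -> f x < k by move=> xU xI; rewrite fk // inE xI.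
split=> [x xU | x y xU yU xy].
  by case: ifPn => // xI; apply: ltnW; apply: fk'.
case: ifPn => xI; case: ifPn => yI.
- by have /negP := stI x y xI yI.
- by rewrite gtn_eqF // fk'.
- by rewrite ltn_eqF // fk'.
- by apply: fP => //; rewrite inE ?xI ?yI.
Qed.

Lemma chromatic_number_le k : colorable_on [set: G] k -> chromatic_number G <= k.
Proof.
case=> f [fk fP]; rewrite /chromatic_number; case: ex_minnP => n _; apply.
apply/existsP; exists [ffun x => Ordinal (fk x (in_setT x))].
apply/forallP=> x; apply/forallP=> y; apply/implyP=> xy; rewrite !ffunE.
by rewrite -val_eqE /= fP.
Qed.

(** By induction on the clique [x :: s]: if [i] is complete to [s] but misses [x],
    take a neighbour [j] of [x] in [I]; were [j] to miss some [y] in [s], then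
    i - y - x - j would be an induced path. *)
Lemma stable_extends_clique U I (s : seq G) :
  (forall p q r t, p \in U -> q \in U -> r \in U -> t \in U ->
     ~~ induced_P4 p q r t) ->
  I \subset U -> I != set0 -> stable I ->
  {in U :\: I, forall x, exists2 i, i \in I & adj i x} ->
  {subset s <= U :\: I} -> pairwise adj s ->
  exists2 i, i \in I & all (adj i) s.
Proof.
move=> noP4 /subsetP IU /set0Pn[i0 i0I] /stableP stI dom.
elim: s => [|x s IH] sU /=; first by exists i0.
case/andP=> /allP xs cls.
have [||i iI /allP is_] := IH => // [y ys|]; first by apply: sU; rewrite inE ys orbT.
have [ix|ix] := boolP (adj i x); first by exists i; rewrite ?ix //; apply/allP.
have xUI : x \in U :\: I by apply: sU; rewrite mem_head.
have [j jI jx] := dom x xUI.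
have [js|/allPn[y ys jy]] := boolP (all (adj j) s); first by exists j; rewrite ?jx.
have /setDP[yU _] : y \in U :\: I by apply: sU; rewrite inE ys orbT.
have /setDP[xU _] := xUI.
have /negP[] := noP4 i y x j (IU _ iI) yU xU (IU _ jI).
rewrite /induced_P4 is_ // ix stI // ![adj _ j]adj_sym jx jy.
by rewrite adj_sym xs.
Qed.

(** Induction on [U], removing a maximal stable set [I]: this costs one colour,
    and by maximality [I] dominates [U], so [stable_extends_clique] adds one of
    its vertices to the clique found in the rest. *)
Lemma P4_free_clique_coloring U :
  (forall p q r t, p \in U -> q \in U -> r \in U -> t \in U ->
     ~~ induced_P4 p q r t) ->
  exists s : seq G, [/\ {subset s <= U}, pairwise adj s & colorable_on U (size s)].
Proof.
have [n] := ubnP #|U|; elim: n U => // n IH U leUn noP4.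
have [U0|/set0Pn[v vU]] := eqVneq U set0.
  by exists [::]; split=> //; exists (fun _ => 0); split=> [x|x y]; rewrite U0 inE.
have [I maxI vI] : {I | maxset (fun I => (I \subset U) && stable I) I & [set v] \subset I}.
  apply: maxset_exists; rewrite sub1set vU; apply/stableP => x y.
  by rewrite !inE => /eqP-> /eqP->; rewrite adj_irrefl.
have /andP[IU stI] := maxsetp maxI.
have {}vI : v \in I by rewrite -sub1set.
have [||s [sU cls col]] := IH (U :\: I).
- rewrite ltnS in leUn; apply: leq_trans leUn; apply: proper_card.
  by apply/properP; split; [exact: subsetDl | exists v; rewrite ?inE ?vI].
- by move=> p q r t /setDP[? _] /setDP[? _] /setDP[? _] /setDP[? _]; apply: noP4.
have [||i iI is_] := @stable_extends_clique U I s noP4 IU _ stI _ sU cls.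
- by apply/set0Pn; exists v.
- move=> x /setDP[xU xI]; apply: contrapT => no; case/negP: xI.
  have noI i : i \in I -> adj i x = false.
    by move=> iI; apply/negP => ix; apply: no; exists i.
  suff <- : x |: I = I by rewrite setU11.
  apply: (maxsetsup maxI); last exact: subsetUr.
  rewrite subUset sub1set xU IU; apply/stableP => y z.
  rewrite !inE => /predU1P[->|yI] /predU1P[->|zI].
  + by rewrite adj_irrefl.
  + by rewrite adj_sym noI.
  + by rewrite noI.
  + by move/stableP: stI; apply.
exists (i :: s); split=> /=; last exact: colorable_on_stable col.
  move=> x; rewrite inE => /predU1P[->|/sU/setDP[]//].
  by move/subsetP: IU; apply.
by rewrite is_.
Qed.

(** * The two stable sets of an induced path *)

(** Besides [r] and [p], these are the vertices that miss [p], [q], [r] and the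
    vertices other than [p] that miss [p], [r], [s]; along an induced path
    p - q - r - s, the former are adjacent to [s] and the latter to [q], by
    [co_gem_free]. *)
Definition P4_side (p q r s : G) : {set G} :=
  r |: [set x | [&& ~~ adj x p, ~~ adj x r & ~~ (adj x q && adj x s)]].

(** By [co_gem_free], every member other than [r] is adjacent to exactly one of
    [q] and [s].  Two adjacent members with the same neighbour among [q] and [s]
    form with it a triangle that the other one of [q] and [s] misses.  If [u] and
    [v] are adjacent members, [u] being adjacent to [s] and [v] to [q], then
    r - s - u - v is an induced path that [p] misses. *)
Lemma P4_side_stable p q r s :
  free (fun H : sgraph => H = co_claw \/ H = co_gem) G ->
  induced_P4 p q r s -> stable (P4_side p q r s).
Proof.
move=> Gfree P; have /and5P[pq qr rs pr /andP[ps qs]] := P; apply/stableP => x y.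
rewrite !inE => /predU1P[->|/and3P[xp xr xqs]] /predU1P[->|/and3P[yp yr yqs]] //.
- by rewrite adj_irrefl.
- by rewrite adj_sym.
have type z : ~~ adj z p -> ~~ adj z r -> ~~ (adj z q && adj z s) ->
    adj z q && ~~ adj z s || adj z s && ~~ adj z q.
  move=> zp zr; case zq : (adj z q); case zs : (adj z s) => // _.
  by case: (@co_gem_free _ _ _ _ _ z Gfree P) => //; rewrite ?zq ?zs.
have cross u v : adj u v -> ~~ adj u p -> ~~ adj u r -> ~~ adj v p -> ~~ adj v r ->
    adj u s -> ~~ adj v s -> False.
  move=> uv up ur vp vr us vs.
  apply: (@co_gem_free _ r s u v p Gfree) => //; last 2 first.
  - by rewrite adj_sym.
  - by rewrite adj_sym.
  by rewrite /induced_P4 rs adj_sym us uv adj_sym ur adj_sym vr adj_sym vs.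
apply/negP => xy.
case/orP: (type x xp xr xqs) => /andP[x1 x2];
  case/orP: (type y yp yr yqs) => /andP[y1 y2].
- by apply: (@co_claw_free _ x y q s Gfree) => //; rewrite adj_sym.
- by apply: (cross y x); rewrite // adj_sym.
- exact: (cross x y).
- by apply: (@co_claw_free _ x y s q Gfree); rewrite // adj_sym.
Qed.

(** A vertex outside both sets that misses [p] and [q] is adjacent to [r], being
    outside the first, and to [s], being outside the second; the resulting
    triangle is missed by [p]. *)
Lemma P4_edge_dominates p q r s x :
  free (fun H : sgraph => H = co_claw \/ H = co_gem) G ->
  induced_P4 p q r s ->
  x \notin P4_side p q r s -> x \notin P4_side s r q p ->
  [exists y in [set p; q], adj y x].
Proof.
move=> Gfree /and5P[pq qr rs pr /andP[ps qs]] xA xB; apply/exists_inP; apply: contrapT => no.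
have xp : adj x p = false.
  by apply/negP => xp; apply: no; exists p; rewrite ?inE ?eqxx // adj_sym.
have xq : adj x q = false.
  by apply/negP => xq; apply: no; exists q; rewrite ?inE ?eqxx ?orbT // adj_sym.
move: xA xB; rewrite !inE xp xq /= !andbT !andbF /= !andbT !negb_or !negbK.
case/andP=> _ xr /andP[_ xs].
apply: (@co_claw_free _ x r s p Gfree) => //.
by rewrite adj_sym xp.
Qed.

(** * The induction *)

Lemma clique_model_coloring U :
  free (fun H : sgraph => H = co_claw \/ H = co_gem) G ->
  exists Bs, clique_model U Bs /\ colorable_on U (size Bs).
Proof.
move=> Gfree; have [n] := ubnP #|U|; elim: n U => // n IH U leUn.
have [[p [q [r [s [[pU qU rU sU] P]]]]]|noP4] := pselect (exists p q r s,
    [/\ p \in U, q \in U, r \in U & s \in U] /\ induced_P4 p q r s); last first.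
  have [|t [tU cl col]] := @P4_free_clique_coloring U.
    by move=> p q r s pU qU rU sU; apply/negP => P; apply: noP4; exists p, q, r, s.
  exists [seq [set x] | x <- t]; rewrite size_map; split=> //; split.
    move=> _ /mapP[x xt ->]; split.
    - by apply/set0Pn; exists x; rewrite inE.
    - by rewrite sub1set tU.
    - by move=> y z; rewrite !inE => /eqP-> /eqP->; rewrite eqxx.
  rewrite pairwise_map; apply: sub_pairwise cl => x y /= xy.
  rewrite /linked disjoints1 inE; apply/andP; split.
    by apply: contraTneq xy => ->; rewrite adj_irrefl.
  by apply/exists_inP; exists x; rewrite ?inE //; apply/exists_inP; exists y; rewrite ?inE.
have P' := induced_P4_rev P.
have /and5P[pq qr rs pr /andP[ps qs]] := P.
pose A := P4_side p q r s; pose B := P4_side s r q p.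
have rA : r \in A by rewrite setU11.
have qB : q \in B by rewrite setU11.
have pA : p \in A by rewrite !inE adj_irrefl pr (negPf ps) andbF orbT.
have sB : s \in B.
  by rewrite !inE adj_irrefl [adj s q]adj_sym qs [adj s p]adj_sym (negPf ps) andbF orbT.
have [|Bs [[blocks link] col]] := IH (U :\: A :\: B).
  rewrite ltnS in leUn; apply: leq_trans leUn; apply: proper_card; apply/properP.
  by split; [rewrite setDDl subsetDl | exists p; rewrite // !in_setD pA andbF].
have newblock u v : u \in U -> v \in U -> adj u v ->
    [/\ [set u; v] != set0, [set u; v] \subset U
      & {in [set u; v] &, forall x y, x != y -> adj x y}].
  move=> uU vU uv; split.
  - by apply/set0Pn; exists u; rewrite !inE eqxx.
  - by rewrite subUset !sub1set uU.
  - move=> x y; rewrite !inE => /orP[]/eqP-> /orP[]/eqP->; rewrite ?eqxx //.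
    by rewrite adj_sym.
(* The blocks of the model of the rest are nonempty, so an edge that dominates
   the rest is linked to each of them. *)
have newlink u v : u \in A -> v \in B ->
    (forall x, x \notin A -> x \notin B -> [exists y in [set u; v], adj y x]) ->
    all (linked [set u; v]) Bs.
  move=> uA vB dom; apply/allP => C /blocks[/set0Pn[x xC] /subsetP CU _].
  have out y : y \in C -> y \notin A /\ y \notin B by move/CU; rewrite !in_setD => /and3P[].
  apply/andP; split.
    rewrite disjoint_subset; apply/subsetP => y; rewrite !inE => /orP[]/eqP->;
      by apply/negP => /out[]; rewrite ?uA ?vB.
  have [xA xB] := out x xC; have /exists_inP[y yuv yx] := dom x xA xB.
  by apply/exists_inP; exists y => //; apply/exists_inP; exists x.
exists [:: [set p; q], [set r; s] & Bs]; split; last first.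
  apply: (colorable_on_stable (P4_side_stable Gfree P)).
  exact: (colorable_on_stable (P4_side_stable Gfree P')).
split=> [C|/=].
  rewrite !inE => /or3P[/eqP->|/eqP->|/blocks[C0 CU cl]].
  - exact: newblock.
  - exact: newblock.
  - by split=> //; apply: subset_trans CU _; rewrite setDDl subsetDl.
rewrite link andbT; apply/andP; split.
  rewrite newlink ?andbT //; last by move=> x; apply: P4_edge_dominates.
  apply/andP; split; last first.
    by apply/exists_inP; exists q; rewrite ?inE ?eqxx ?orbT //; apply/exists_inP;
       exists r; rewrite ?inE ?eqxx ?orbT.
  have ne (x y z : G) : adj z x -> ~~ adj z y -> x != y.
    by move=> zx; apply: contraNneq => <-.
  have np : p != s by apply: (ne _ _ q) => //; rewrite adj_sym.
  have nr : r != p by apply: (ne _ _ s); rewrite adj_sym.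
  have nq : q != s by apply: (ne _ _ p).
  have nr' : r != q by apply: (ne _ _ s); rewrite adj_sym.
  rewrite disjoint_subset; apply/subsetP => y.
  by rewrite !inE => /orP[]/eqP->; rewrite negb_or ?np ?nq eq_sym ?nr ?nr'.
(* Reversing the path exchanges the two stable sets. *)
apply: newlink => // x xA xB; rewrite setUC; exact: P4_edge_dominates Gfree P' xB xA.
Qed.

End Models.

Theorem theorem1p3 (G : sgraph)
    (G_free : free (fun H : sgraph => H = co_claw \/ H = co_gem) G) :
  hadwiger_number G >= chromatic_number G.
Proof.
have [Bs [model col]] := clique_model_coloring [set: G] G_free.
apply: leq_trans (chromatic_number_le col) _.
rewrite /hadwiger_number; case: ex_maxnP => n _; apply.
by apply/asboolP; apply: clique_model_minor.
Qed.
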